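(* Let $q\in\mathbb{C}$ with $|q|<1$. Then $$\sum_{n=0}^\infty(-1)^nq^{n(3n+2)}(1+q^{2n+1})=\cfrac{1}{1-q+\cfrac{q^2-q^3}{1-q^3+\cfrac{q^4-q^2}{1-q^5+\cfrac{q^6-q^9}{1-q^7+\cfrac{q^8-q^4}{1-q^9+\cfrac{q^{10}-q^{15}}{1-q^{11}+\cfrac{q^{12}-q^6}{1-q^{13}+\cdots}}}}}}},$$ i.e. the left side equals $\cfrac{1}{b_0+\cfrac{a_1}{b_1+\cfrac{a_2}{b_2+\cdots}}}$ with $b_k=1-q^{2k+1}$ for $k\ge0$, and $a_{2n-1}=q^{4n-2}-q^{6n-3}$, $a_{2n}=q^{4n}-q^{2n}$ for $n\ge1$.
   Context: For complex sequences with all partial numerators $a_k\neq0$ (so $q\neq0$ here), an infinite continued fraction has value $f\in\mathbb{C}\cup\{\infty\}$ if its finite truncations (approximants) $\cfrac{1}{b_0+\cfrac{a_1}{b_1+\cdots+\cfrac{a_n}{b_n}}}$ converge to $f$ as $n\to\infty$. *)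

(* Defs.v *)
From Stdlib Require Import Reals.
From Coquelicot Require Import Coquelicot.
Open Scope C_scope.

(** The Riemann sphere, the one-point compactification of [C]. *)
Inductive Cbar : Type :=
  | Cfin : C -> Cbar
  | Cinf : Cbar.

Definition Cbar_locally (f : Cbar) (P : Cbar -> Prop) : Prop :=
  match f with
  | Cfin z => locally z (fun w : C => P (Cfin w))
  | Cinf => P Cinf /\ exists M : R, forall w : C, (M < Cmod w)%R -> P (Cfin w)
  end.

Definition Cbar_plus (b : C) (w : Cbar) : Cbar :=
  match w with
  | Cfin z => Cfin (b + z)
  | Cinf => Cinf
  end.

(** [a / w] on the sphere.  The map is total; [a / 0 = Cinf] is the usual
    convention for [a <> 0], while the value [0 / 0 = Cinf] is a dummy. *)
Definition Cbar_div (a : C) (w : Cbar) : Cbar :=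
  match w with
  | Cfin z => if Ceq_dec z 0 then Cinf else Cfin (a / z)
  | Cinf => Cfin 0
  end.

(** [cf_tail a b k m] is b_k + a_(k+1)/(b_(k+1) + ... + a_(k+m)/b_(k+m)),
    computed on the sphere. *)
Fixpoint cf_tail (a b : nat -> C) (k m : nat) : Cbar :=
  match m with
  | O => Cfin (b k)
  | S m' => Cbar_plus (b k) (Cbar_div (a (S k)) (cf_tail a b (S k) m'))
  end.

(** 1/(b_0 + a_1/(b_1 + ... + a_n/b_n)); the entry [a 0] is not used. *)
Definition cf_approximant (a b : nat -> C) (n : nat) : Cbar :=
  Cbar_div 1 (cf_tail a b 0 n).

Definition cf_has_value (a b : nat -> C) (f : Cbar) : Prop :=
  filterlim (cf_approximant a b) eventually (Cbar_locally f).

(* Main.v *)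
(** Put [G(x,y,z) = sum_n (-1)^n q^(n^2) x^n (y;q^2)_n / ((q^2;q^2)_n (z;q^2)_n)].
    Two contiguous relations of [G] show that
    [W_(2m) = G(q^(2m+1), q^(2m), q^(4m+1))] and
    [W_(2m+1) = G(q^(2m+1), q^(2m+2), q^(4m+3))] satisfy
    [W_k = W_(k+1) + a_(k+1) / (b_k b_(k+1)) W_(k+2)], so that
    [V_k = W_k / (b_0 ... b_(k-1))] solves
    [V_k = b_k V_(k+1) + a_(k+1) V_(k+2)], with [W_0 = 1] and [W_k -> 1].
    As in Pincherle's theorem the continued fraction then has the value
    [V_1 / V_0 = W_1 / (1 - q)]: for large [k] the maps [w |-> b_k + a_(k+1) / w]
    are contractions near [1], hence the tails converge to [V_k / V_(k+1)], and this
    is carried back to [k = 0] by continuity of Moebius maps on the sphere.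
    Finally, iterating a limiting Rogers-Fine identity for [W_1 = G(q, q^2, q^3)]
    yields the false theta series. *)
Require Import Defs.
From Stdlib Require Import Reals Lra Lia.
From Coquelicot Require Import Coquelicot.
Open Scope C_scope.

(** * Continued fractions on the sphere *)

Lemma Cmod_sub_ge (x y : C) : (Cmod x - Cmod y <= Cmod (x - y))%R.
Proof.
  pose proof (Cmod_triangle (x - y) y) as H.
  replace (x - y + y) with x in H by ring. lra.
Qed.

Lemma Cmod_sub_comm (x y : C) : Cmod (x - y) = Cmod (y - x).
Proof. rewrite <- Cmod_opp. f_equal. ring. Qed.

(** [locally] on [C] comes from the product balls; this passes to the discs of [Cmod]. *)
Lemma locally_C_Cmod (z : C) (P : C -> Prop) :
  locally z P <->
  exists eps : R, (0 < eps)%R /\ forall w, (Cmod (w - z) < eps)%R -> P w.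
Proof.
  split.
  - intros H.
    destruct (locally_norm_le_locally (V := C_NormedModule) z P H) as [eps H'].
    exists eps. split; [apply cond_pos|]. intros w Hw. apply H'. exact Hw.
  - intros [eps [He H]]. apply (locally_le_locally_norm (V := C_NormedModule)).
    exists (mkposreal eps He). intros w Hw. apply H. exact Hw.
Qed.

Lemma filterlim_C_eps (u : nat -> C) (l : C) :
  (forall eps : R, (0 < eps)%R ->
     exists N, forall n, (N <= n)%nat -> (Cmod (u n - l) < eps)%R) ->
  filterlim u eventually (locally l).
Proof.
  intros H P HP. apply locally_C_Cmod in HP. destruct HP as [eps [He HP]].
  destruct (H eps He) as [N HN]. exists N. intros n Hn. apply HP, HN, Hn.
Qed.

Lemma Cbar_plus_continuous (b : C) (w : Cbar) :
  filterlim (Cbar_plus b) (Cbar_locally w) (Cbar_locally (Cbar_plus b w)).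
Proof.
  destruct w as [z|]; intros P HP; unfold filtermap.
  - apply locally_C_Cmod in HP. destruct HP as [eps [He HP]].
    apply locally_C_Cmod. exists eps. split; [easy|].
    intros w Hw. apply HP. replace (b + w - (b + z)) with (w - z) by ring. easy.
  - destruct HP as [HP0 [M HP]]. split; [easy|].
    exists (M + Cmod b)%R. intros w Hw. apply HP.
    pose proof (Cmod_sub_ge w (- b)) as H. rewrite Cmod_opp in H.
    replace (w - - b) with (b + w) in H by ring. lra.
Qed.

Lemma Cbar_div_continuous (a : C) (w : Cbar) : a <> 0 ->
  filterlim (Cbar_div a) (Cbar_locally w) (Cbar_locally (Cbar_div a w)).
Proof.
  intros Ha. pose proof (proj1 (Cmod_gt_0 a) Ha) as Ha'.
  destruct w as [z|]; [simpl; destruct (Ceq_dec z 0) as [->|Hz]|];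
    intros P HP; unfold filtermap.
  - destruct HP as [HP0 [M HP]]. apply locally_C_Cmod.
    assert (HM : (0 < Rabs M + 1)%R) by (pose proof (Rabs_pos M); lra).
    exists (Cmod a / (Rabs M + 1))%R.
    split; [now apply Rdiv_lt_0_compat|].
    intros w Hw. simpl. destruct (Ceq_dec w 0) as [->|Hw0]; [easy|].
    apply HP. replace (w - 0) with w in Hw by ring.
    pose proof (proj1 (Cmod_gt_0 w) Hw0) as Hw0'.
    rewrite Cmod_div by easy. apply Rlt_div_r; [easy|].
    apply Rlt_div_r in Hw; [|easy].
    pose proof (Rle_abs M). nra.
  - apply locally_C_Cmod in HP. destruct HP as [eps [He HP]].
    pose proof (proj1 (Cmod_gt_0 z) Hz) as Hz'.
    apply locally_C_Cmod.
    (* The first bound keeps [|w| > |z|/2]; then [|a/w - a/z|] is at most [2|a||w - z|/|z|^2], which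
       the second bound makes less than [eps]. *)
    exists (Rmin (Cmod z / 2) (eps * Cmod z * Cmod z / (2 * Cmod a)))%R.
    split.
    { apply Rmin_glb_lt; [lra|]. apply Rdiv_lt_0_compat; [|lra].
      apply Rmult_lt_0_compat; [|easy]. now apply Rmult_lt_0_compat. }
    intros w Hw. apply Rmin_Rgt in Hw. destruct Hw as [Hw1 Hw2].
    pose proof (Cmod_sub_ge z w) as H1. rewrite Cmod_sub_comm in H1.
    assert (Hwp : (Cmod z / 2 < Cmod w)%R) by lra.
    assert (Hw0 : w <> 0) by (apply Cmod_gt_0; lra).
    simpl. destruct (Ceq_dec w 0) as [?|_]; [easy|].
    apply HP. replace (a / w - a / z) with (a * (z - w) / (w * z)) by (now field).
    rewrite Cmod_div by now apply Cmult_neq_0.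
    rewrite !Cmod_mult, Cmod_sub_comm.
    apply Rlt_div_l; [apply Rmult_lt_0_compat; lra|].
    apply Rgt_lt, Rlt_div_r in Hw2; [|lra].
    apply Rlt_trans with (eps * Cmod z * Cmod z / 2)%R; [lra|].
    pose proof (Rmult_lt_0_compat _ _ He Hz'). nra.
  - apply locally_C_Cmod in HP. destruct HP as [eps [He HP]].
    assert (H0 : (0 < Cmod a / eps)%R) by now apply Rdiv_lt_0_compat.
    split.
    + simpl. destruct (Ceq_dec 0 0) as [_|?]; [|easy]. apply HP.
      replace (0 - 0) with (RtoC 0) by ring. now rewrite Cmod_0.
    + exists (Cmod a / eps)%R. intros w Hw.
      assert (Hw0 : w <> 0) by (apply Cmod_gt_0; lra).
      simpl. destruct (Ceq_dec w 0) as [?|_]; [easy|]. apply HP.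
      replace (a / w - 0) with (a / w) by ring.
      rewrite Cmod_div by easy. apply Rlt_div_l; [lra|].
      apply Rlt_div_l in Hw; [|easy]. lra.
Qed.

(* [Cbar_div u (Cfin v)] is the point of the sphere with homogeneous coordinates
   [u : v]. *)
Lemma Cbar_div_div (a u v : C) : u <> 0 \/ v <> 0 ->
  Cbar_div a (Cbar_div u (Cfin v)) = Cbar_div (a * v) (Cfin u).
Proof.
  intros H. simpl. destruct (Ceq_dec v 0) as [->|Hv]; simpl.
  - destruct (Ceq_dec u 0) as [->|Hu]; [now destruct H|].
    f_equal. now field.
  - destruct (Ceq_dec u 0) as [->|Hu].
    + destruct (Ceq_dec (0 / v) 0) as [_|H0]; [easy|].
      destruct H0. now field.
    + destruct (Ceq_dec (u / v) 0) as [H0|_].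
      * destruct Hu. replace u with (u / v * v) by (now field).
        rewrite H0. ring.
      * f_equal. field. easy.
Qed.

Lemma Cbar_plus_div (b c u : C) :
  Cbar_plus b (Cbar_div c (Cfin u)) = Cbar_div (b * u + c) (Cfin u).
Proof.
  simpl. destruct (Ceq_dec u 0) as [->|Hu]; simpl; [easy|].
  f_equal. now field.
Qed.

Lemma filterlim_eventually_S {T : Type} (f : nat -> T) (G : (T -> Prop) -> Prop) :
  filterlim (fun n => f (S n)) eventually G -> filterlim f eventually G.
Proof.
  intros H P HP. destruct (H P HP) as [N HN]. exists (S N).
  intros [|n] Hn; [lia|]. apply HN. lia.
Qed.

(** * Convergence of the tails from a slowly varying solution *)

Section Pincherle.

Variables a b V : nat -> C.
Variable K : nat.
Hypothesis a_neq_0 : forall k, (k < K)%nat -> a (S k) <> 0.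
Hypothesis b_close : forall k, (K <= k)%nat -> (Cmod (b k - 1) <= 1 / 4)%R.
Hypothesis a_small : forall k, (K <= k)%nat -> (Cmod (a (S k)) <= 1 / 8)%R.
Hypothesis V_rec : forall k, V k = b k * V (S k) + a (S k) * V (S (S k)).
Hypothesis V_neq_0 : forall k, (K <= k)%nat -> V k <> 0.
Hypothesis V_slow : forall k, (K <= k)%nat -> (Cmod (V (S k)) <= 2 * Cmod (V k))%R.

(** On [|w| >= 1/2] the map [b_k + a_(k+1)/w] has Lipschitz constant [(1/8)/(1/4) = 1/2], and it
    preserves this region because [3/4 - 1/4 = 1/2]. The ratios [V_k/V_(k+1)] are an orbit of the
    same maps, and [V_slow] places them in the region. *)
Lemma cf_tail_contract (m k : nat) : (K <= k)%nat ->
  exists t : C, cf_tail a b k m = Cfin t /\ (1 / 2 <= Cmod t)%R /\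
    (Cmod (t - V k / V (S k)) <= (1 / 2) ^ m)%R.
Proof.
  revert k. induction m as [|m IH]; intros k Hk.
  all: pose proof (b_close k Hk) as Hb; pose proof (a_small k Hk) as Ha.
  all: pose proof (Cmod_ge_0 (a (S k))) as Ha0.
  all: pose proof (Cmod_sub_ge 1 (1 - b k)) as H1; rewrite Cmod_1 in H1;
    replace (1 - (1 - b k)) with (b k) in H1 by ring;
    rewrite (Cmod_sub_comm 1) in H1.
  all: assert (HV1 := V_neq_0 (S k) ltac:(lia)).
  all: assert (HV2 := V_neq_0 (S (S k)) ltac:(lia)).
  all: pose proof (proj1 (Cmod_gt_0 _) HV1) as HV1'.
  all: pose proof (V_slow (S k) ltac:(lia)) as HV.
  - exists (b k). split; [easy|]. split; [lra|].
    rewrite (V_rec k), pow_O.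
    replace (b k - (b k * V (S k) + a (S k) * V (S (S k))) / V (S k))
      with (- (a (S k) * V (S (S k)) / V (S k))) by (now field).
    rewrite Cmod_opp, Cmod_div, Cmod_mult by easy.
    apply Rle_div_l; [easy|]. nra.
  - destruct (IH (S k) ltac:(lia)) as [t [Ht [Ht1 Ht2]]].
    assert (Ht0 : t <> 0) by (apply Cmod_gt_0; lra).
    exists (b k + a (S k) / t). split; [|split].
    + simpl. rewrite Ht. simpl. now destruct (Ceq_dec t 0).
    + pose proof (Cmod_sub_ge (b k) (- (a (S k) / t))) as H2.
      replace (b k - - (a (S k) / t)) with (b k + a (S k) / t) in H2 by ring.
      rewrite Cmod_opp, Cmod_div in H2 by easy.
      assert (Cmod (a (S k)) / Cmod t <= 1 / 4)%R
        by (apply Rle_div_l; lra).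
      lra.
    + set (s := V (S k) / V (S (S k))) in *.
      assert (Hs : (1 / 2 <= Cmod s)%R).
      { unfold s. rewrite Cmod_div by easy. apply (Rle_div_r (1 / 2)); [now apply Cmod_gt_0|lra]. }
      assert (Hs0 : s <> 0) by (apply Cmod_gt_0; lra).
      replace (V k / V (S k)) with (b k + a (S k) / s)
        by (unfold s; rewrite (V_rec k); field; easy).
      replace (b k + a (S k) / t - (b k + a (S k) / s))
        with (a (S k) * (s - t) / (t * s)) by (field; easy).
      rewrite Cmod_div by now apply Cmult_neq_0.
      rewrite !Cmod_mult, Cmod_sub_comm.
      pose proof (Cmod_ge_0 (t - s)).
      apply Rle_div_l; [apply Rmult_lt_0_compat; lra|].
      assert (1 / 4 <= Cmod t * Cmod s)%R by nra.
      assert (Cmod (a (S k)) * Cmod (t - s) <= 1 / 8 * (1 / 2) ^ m)%R by nra.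
      assert (0 <= (1 / 2) ^ m)%R by (apply pow_le; lra).
      simpl. nra.
Qed.

(** Two consecutive zeros below [K] would propagate upwards through the recurrence, as
    [a_(k+1) <> 0], and reach [V K]. Hence [[V k : V (S k)]] is a genuine point of the sphere. *)
Lemma solution_nontrivial (k : nat) : (k <= K)%nat -> V k <> 0 \/ V (S k) <> 0.
Proof.
  intros Hk. replace k with (K - (K - k))%nat by lia.
  assert (Hd : (K - k <= K)%nat) by lia. revert Hd.
  generalize (K - k)%nat as d. clear k Hk. induction d as [|d IH]; intros Hd.
  - left. apply V_neq_0. lia.
  - replace (K - d)%nat with (S (K - S d)) in IH by lia.
    destruct (Ceq_dec (V (S (K - S d))) 0) as [E|]; [|now right].
    left. intros E0. rewrite V_rec, E in E0.
    destruct IH as [IH|IH]; [lia|easy|].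
    apply (Cmult_neq_0 _ _ (a_neq_0 (K - S d) ltac:(lia)) IH).
    rewrite <- E0. ring.
Qed.

(** At [K] the contraction gives a finite limit. Below [K] the entries [V k] may vanish, so the
    limit is carried down as a point of the sphere, by continuity of one Moebius map per step. *)
Lemma cf_tail_limit (k : nat) : (k <= K)%nat ->
  filterlim (cf_tail a b k) eventually
    (Cbar_locally (Cbar_div (V k) (Cfin (V (S k))))).
Proof.
  (* Downward induction from [K], expressed as induction on [d = K - k]. *)
  intros Hk. replace k with (K - (K - k))%nat by lia.
  assert (Hd : (K - k <= K)%nat) by lia. revert Hd.
  generalize (K - k)%nat as d. clear k Hk. induction d as [|d IH]; intros Hd.
  - replace (K - 0)%nat with K by lia.
    simpl. assert (HV := V_neq_0 (S K) ltac:(lia)).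
    destruct (Ceq_dec (V (S K)) 0) as [?|_]; [easy|].
    intros P HP. apply locally_C_Cmod in HP. destruct HP as [eps [He HP]].
    assert (Hl : Rabs (1 / 2) < 1) by (rewrite Rabs_pos_eq; lra).
    destruct (pow_lt_1_zero (1 / 2) Hl eps He) as [N HN].
    exists N. intros m Hm.
    destruct (cf_tail_contract m K (le_n K)) as [t [-> [_ Ht]]].
    apply HP. eapply Rle_lt_trans; [apply Ht|].
    eapply Rle_lt_trans; [apply Rle_abs|]. now apply HN.
  - replace (K - d)%nat with (S (K - S d)) in IH by lia.
    set (k := (K - S d)%nat) in *.
    assert (Hak : a (S k) <> 0) by (apply a_neq_0; lia).
    (* Discarding the truncation of depth 0 lets every remaining tail unfold by one level. *)
    apply filterlim_eventually_S.
    rewrite V_rec, <- Cbar_plus_div, <- Cbar_div_div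
      by (apply solution_nontrivial; lia).
    apply (filterlim_comp _ _ _ (fun m => Cbar_div (a (S k)) (cf_tail a b (S k) m))
             (Cbar_plus (b k)) _
             (Cbar_locally (Cbar_div (a (S k)) (Cbar_div (V (S k)) (Cfin (V (S (S k)))))))).
    2: apply Cbar_plus_continuous.
    apply (filterlim_comp _ _ _ (cf_tail a b (S k)) (Cbar_div (a (S k))) _
             (Cbar_locally (Cbar_div (V (S k)) (Cfin (V (S (S k))))))).
    2: now apply Cbar_div_continuous.
    apply IH. lia.
Qed.

Lemma cf_value_of_slow_solution :
  cf_has_value a b (Cbar_div (V 1%nat) (Cfin (V 0%nat))).
Proof.
  unfold cf_has_value, cf_approximant.
  replace (V 1%nat) with (1 * V 1%nat) by ring.
  rewrite <- Cbar_div_div by (apply solution_nontrivial; lia).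
  apply (filterlim_comp _ _ _ (cf_tail a b 0) (Cbar_div 1) _
           (Cbar_locally (Cbar_div (V 0%nat) (Cfin (V 1%nat))))).
  - apply cf_tail_limit. lia.
  - apply Cbar_div_continuous. intros E. apply (f_equal fst) in E. simpl in E. lra.
Qed.

End Pincherle.

(** * q-series *)

(** A definite description keeps [G] total; its meaning rests on a separate proof of convergence. *)
Definition csum (u : nat -> C) : C := iota (T := C_CompleteNormedModule) (is_series u).

Lemma is_series_csum (u : nat -> C) : ex_series u -> is_series u (csum u).
Proof.
  intros [l Hl]. unfold csum.
  rewrite (iota_unique (V := C_CompleteNormedModule) (is_series u) l); [easy| |easy].
  intros l' Hl'. exact (filterlim_locally_unique _ _ _ Hl' Hl).
Qed.

Lemma is_series_ext_eq (u v : nat -> C) (lu lv : C) :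
  is_series u lu -> is_series v lv -> (forall n, u n = v n) -> lu = lv.
Proof.
  intros Hu Hv E. apply (is_series_ext _ _ _ E) in Hu.
  exact (filterlim_locally_unique _ _ _ Hu Hv).
Qed.

Lemma is_series_sub_eq (u v w : nat -> C) (lu lv lw : C) :
  is_series u lu -> is_series v lv -> is_series w lw ->
  (forall n, u n - v n = w n) -> lu - lv = lw.
Proof.
  intros Hu Hv Hw E. refine (is_series_ext_eq _ w _ _ _ Hw E).
  exact (is_series_minus _ _ _ _ Hu Hv).
Qed.

Lemma is_series_Cmod_le (u : nat -> C) (v : nat -> R) (l : C) (L : R) :
  (forall n, Cmod (u n) <= v n)%R -> is_series u l -> is_series v L ->
  (Cmod l <= L)%R.
Proof.
  intros Huv Hu Hv.
  assert (Hn : filterlim (fun n => norm (sum_n u n)) eventually (locally (norm l)))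
    by exact (filterlim_comp _ _ _ _ _ _ _ _ Hu (filterlim_norm l)).
  apply (is_lim_seq_le (fun n => norm (sum_n u n)) (sum_n v) (Cmod l) L).
  - intros n. eapply Rle_trans; [apply (norm_sum_n_m (V := C_NormedModule) u 0 n)|].
    apply sum_n_m_le. exact Huv.
  - exact Hn.
  - exact Hv.
Qed.

(** This is [c^n r^(n(n-1)/2)], summable for every [c] once [r < 1]. *)
Fixpoint majorant (c r : R) (n : nat) : R :=
  match n with
  | O => 1
  | S m => majorant c r m * (c * r ^ m)
  end.

Lemma majorant_ge_0 (c r : R) (n : nat) :
  (0 <= c)%R -> (0 <= r)%R -> (0 <= majorant c r n)%R.
Proof.
  intros Hc Hr. induction n as [|n IH]; simpl; [lra|].
  apply Rmult_le_pos; [easy|]. apply Rmult_le_pos; [easy|]. now apply pow_le.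
Qed.

Lemma eventually_mult_pow_lt (c r eps : R) :
  (0 <= c)%R -> (0 <= r < 1)%R -> (0 < eps)%R ->
  exists N, forall n, (N <= n)%nat -> (c * r ^ n < eps)%R.
Proof.
  intros Hc Hr He.
  assert (Hl : Rabs r < 1) by (rewrite Rabs_pos_eq; lra).
  assert (Hd : (0 < eps / (c + 1))%R) by (apply Rdiv_lt_0_compat; lra).
  destruct (pow_lt_1_zero r Hl _ Hd) as [N HN].
  exists N. intros n Hn.
  pose proof (Rle_lt_trans _ _ _ (Rle_abs _) (HN n Hn)) as H.
  apply Rlt_div_r in H; [|lra].
  assert (0 <= r ^ n)%R by (apply pow_le; lra). nra.
Qed.

(** The ratio [c r^n] of consecutive terms is eventually below [1/2], so a geometric series
    dominates from there on. *)
Lemma ex_series_majorant (c r : R) :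
  (0 <= c)%R -> (0 <= r < 1)%R -> ex_series (majorant c r).
Proof.
  intros Hc Hr.
  destruct (eventually_mult_pow_lt c r (1 / 2) Hc Hr) as [N HN]; [lra|].
  apply (ex_series_incr_n _ N).
  apply (ex_series_le (V := R_CompleteNormedModule) _ (fun k => majorant c r N * (1 / 2) ^ k)%R).
  - intros k. change (norm ?x) with (Rabs x).
    rewrite Rabs_pos_eq by (apply majorant_ge_0; lra).
    induction k as [|k IH].
    + rewrite Nat.add_0_r. simpl. lra.
    + rewrite Nat.add_succ_r. simpl.
      pose proof (HN (N + k)%nat ltac:(lia)) as H.
      pose proof (majorant_ge_0 c r (N + k) Hc (proj1 Hr)).
      assert (0 <= c * r ^ (N + k))%R by (apply Rmult_le_pos; [lra|apply pow_le; lra]).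
      nra.
  - apply (ex_series_scal_l (V := R_NormedModule) (majorant c r N) (fun k => (1 / 2) ^ k)%R).
    apply ex_series_geom. rewrite Rabs_pos_eq; lra.
Qed.

(** [gterm q x y z n] is
    [(-1)^n q^(n^2) x^n (y; q^2)_n / ((q^2; q^2)_n (z; q^2)_n)]. *)
Fixpoint gterm (q x y z : C) (n : nat) : C :=
  match n with
  | O => 1
  | S m => gterm q x y z m *
      (- (q * x * q ^ (2 * m) * (1 - y * q ^ (2 * m))) /
         ((1 - q * q * q ^ (2 * m)) * (1 - z * q ^ (2 * m))))
  end.

Lemma gterm_S (q x y z : C) (n : nat) :
  gterm q x y z (S n) = gterm q x y z n *
    (- (q * x * q ^ (2 * n) * (1 - y * q ^ (2 * n))) /
       ((1 - q * q * q ^ (2 * n)) * (1 - z * q ^ (2 * n)))).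
Proof. reflexivity. Qed.

Definition G (q x y z : C) : C := csum (gterm q x y z).

(** The [2] bounds [|1 - y q^(2n)|] and each [1 - Cmod q] bounds a denominator factor from below, so
    the majorant is uniform in [x], [y], [z]. *)
Definition gbound (q : C) : nat -> R :=
  majorant (2 / ((1 - Cmod q) * (1 - Cmod q))) (Cmod q).

Lemma pow_2S (q : C) (n : nat) : q ^ (2 * S n) = q * q * q ^ (2 * n).
Proof. replace (2 * S n)%nat with (S (S (2 * n))) by lia. rewrite !Cpow_S. ring. Qed.

Lemma pow_le_1 (r : R) (n : nat) : (0 <= r <= 1)%R -> (0 <= r ^ n <= 1)%R.
Proof.
  intros Hr. split; [now apply pow_le|].
  rewrite <- (pow1 n). now apply pow_incr.
Qed.

Lemma Cmod_pow_le_1 (q : C) (n : nat) : (Cmod q < 1)%R -> (Cmod (q ^ n) <= 1)%R.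
Proof.
  intros Hq. rewrite Cmod_pow. apply pow_le_1.
  pose proof (Cmod_ge_0 q). lra.
Qed.

Lemma Cmod_pow_S_le (q : C) (n : nat) :
  (Cmod q < 1)%R -> (Cmod (q ^ S n) <= Cmod q)%R.
Proof.
  intros Hq. rewrite Cpow_S, Cmod_mult.
  pose proof (Cmod_pow_le_1 q n Hq). pose proof (Cmod_ge_0 q). nra.
Qed.

Lemma Cmod_one_sub_ge (q w : C) :
  (Cmod w <= Cmod q)%R -> (1 - Cmod q <= Cmod (1 - w))%R.
Proof.
  intros H. pose proof (Cmod_sub_ge 1 w) as H1. rewrite Cmod_1 in H1. lra.
Qed.

Lemma one_sub_neq_0 (w : C) : (Cmod w < 1)%R -> 1 - w <> 0.
Proof.
  intros H. apply Cmod_gt_0.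
  pose proof (Cmod_one_sub_ge w w (Rle_refl _)). lra.
Qed.

Lemma Cmod_mult_le_l (z w : C) (r : R) :
  (Cmod z <= r)%R -> (Cmod w <= 1)%R -> (Cmod (z * w) <= r)%R.
Proof.
  intros Hz Hw. rewrite Cmod_mult.
  pose proof (Cmod_ge_0 z). pose proof (Cmod_ge_0 w). nra.
Qed.

(** * Convergence of [G] and bounds uniform in its parameters *)

Section Convergence.

Variables q x y z : C.
Hypothesis Hq : (Cmod q < 1)%R.
Hypothesis Hx : (Cmod x <= 1)%R.
Hypothesis Hy : (Cmod y <= 1)%R.
Hypothesis Hz : (Cmod z <= Cmod q)%R.

Lemma Cmod_gterm_S (n : nat) :
  (Cmod (gterm q x y z (S n)) <= Cmod (gterm q x y z n) * (Cmod x *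
     (2 / ((1 - Cmod q) * (1 - Cmod q)) * Cmod q ^ n)))%R.
Proof.
  simpl gterm. rewrite Cmod_mult. apply Rmult_le_compat_l; [apply Cmod_ge_0|].
  replace (n + (n + 0))%nat with (2 * n)%nat by lia.
  pose proof (Cmod_pow_le_1 q (2 * n) Hq) as HQ.
  assert (HQn : (Cmod (q ^ (2 * n)) <= Cmod q ^ n)%R).
  { rewrite Cmod_pow. replace (2 * n)%nat with (n + n)%nat by lia. rewrite pow_add.
    pose proof (pow_le_1 (Cmod q) n ltac:(pose proof (Cmod_ge_0 q); lra)). nra. }
  set (Q := q ^ (2 * n)) in *.
  assert (H1 : (1 - Cmod q <= Cmod (1 - q * q * Q))%R).
  { apply Cmod_one_sub_ge. apply Cmod_mult_le_l; [|easy].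
    apply Cmod_mult_le_l; lra. }
  assert (H2 : (1 - Cmod q <= Cmod (1 - z * Q))%R).
  { apply Cmod_one_sub_ge. now apply Cmod_mult_le_l. }
  assert (H3 : (Cmod (1 - y * Q) <= 2)%R).
  { pose proof (Cmod_triangle 1 (- (y * Q))) as H. rewrite Cmod_1, Cmod_opp in H.
    pose proof (Cmod_mult_le_l y Q 1 Hy HQ).
    unfold Cminus. lra. }
  assert (1 - q * q * Q <> 0) by (apply Cmod_gt_0; lra).
  assert (1 - z * Q <> 0) by (apply Cmod_gt_0; lra).
  rewrite Cmod_div by now apply Cmult_neq_0.
  rewrite Cmod_opp, !Cmod_mult.
  assert (Hn : (Cmod q * Cmod x * Cmod Q * Cmod (1 - y * Q)
     <= Cmod x * (2 * Cmod q ^ n))%R).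
  { pose proof (Cmod_ge_0 q). pose proof (Cmod_ge_0 x). pose proof (Cmod_ge_0 Q).
    pose proof (Cmod_ge_0 (1 - y * Q)).
    assert (Cmod Q * Cmod (1 - y * Q) <= 2 * Cmod q ^ n)%R by nra.
    assert (0 <= Cmod Q * Cmod (1 - y * Q))%R by now apply Rmult_le_pos.
    assert (Cmod q * (Cmod Q * Cmod (1 - y * Q)) <= 2 * Cmod q ^ n)%R by nra.
    nra. }
  assert (Hd : ((1 - Cmod q) * (1 - Cmod q) <=
     Cmod (1 - q * q * Q) * Cmod (1 - z * Q))%R)
    by (apply Rmult_le_compat; lra).
  assert (0 < (1 - Cmod q) * (1 - Cmod q))%R by (apply Rmult_lt_0_compat; lra).
  apply Rle_trans with (Cmod x * (2 * Cmod q ^ n) / ((1 - Cmod q) * (1 - Cmod q)))%R.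
  2: right; field; lra.
  unfold Rdiv. apply Rmult_le_compat.
  - repeat apply Rmult_le_pos; apply Cmod_ge_0.
  - left. apply Rinv_0_lt_compat. lra.
  - exact Hn.
  - apply Rinv_le_contravar; lra.
Qed.

Lemma gbound_ge_0 (n : nat) : (0 <= gbound q n)%R.
Proof.
  apply majorant_ge_0; [|apply Cmod_ge_0].
  left. apply Rdiv_lt_0_compat; [lra|]. apply Rmult_lt_0_compat; lra.
Qed.

Lemma ex_series_gbound : ex_series (gbound q).
Proof.
  apply ex_series_majorant; [|split; [apply Cmod_ge_0|easy]].
  left. apply Rdiv_lt_0_compat; [lra|]. apply Rmult_lt_0_compat; lra.
Qed.

Lemma Cmod_gterm_le (n : nat) : (Cmod (gterm q x y z n) <= gbound q n)%R.
Proof.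
  induction n as [|n IH]; [simpl; rewrite Cmod_1; unfold gbound; simpl; lra|].
  eapply Rle_trans; [apply Cmod_gterm_S|].
  pose proof (gbound_ge_0 (S n)) as H0. unfold gbound in *. simpl in *.
  pose proof (Cmod_ge_0 (gterm q x y z n)). pose proof (Cmod_ge_0 x).
  assert (Hc : (0 <= 2 / ((1 - Cmod q) * (1 - Cmod q)) * Cmod q ^ n)%R).
  { apply Rmult_le_pos; [|apply pow_le, Cmod_ge_0].
    left. apply Rdiv_lt_0_compat; [lra|]. apply Rmult_lt_0_compat; lra. }
  apply Rmult_le_compat; nra.
Qed.

Lemma Cmod_gterm_S_le (n : nat) :
  (Cmod (gterm q x y z (S n)) <= Cmod x * gbound q (S n))%R.
Proof.
  eapply Rle_trans; [apply Cmod_gterm_S|].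
  pose proof (Cmod_gterm_le n) as H. unfold gbound in *. simpl.
  rewrite <- Rmult_assoc, (Rmult_comm _ (Cmod x)), Rmult_assoc.
  apply Rmult_le_compat_l; [apply Cmod_ge_0|].
  apply Rmult_le_compat_r; [|easy].
  apply Rmult_le_pos; [|apply pow_le, Cmod_ge_0].
  left. apply Rdiv_lt_0_compat; [lra|]. apply Rmult_lt_0_compat; lra.
Qed.

Lemma is_series_gterm : is_series (gterm q x y z) (G q x y z).
Proof.
  apply is_series_csum.
  apply (ex_series_le (V := C_CompleteNormedModule) _ (gbound q)).
  - intros n. apply Cmod_gterm_le.
  - apply ex_series_gbound.
Qed.

Lemma is_series_gterm_S : is_series (fun n => gterm q x y z (S n)) (G q x y z - 1).
Proof.
  apply (is_series_incr_1 (V := C_NormedModule)).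
  change (is_series (gterm q x y z) (G q x y z - 1 + 1)).
  replace (G q x y z - 1 + 1) with (G q x y z) by ring. apply is_series_gterm.
Qed.

(** Every term after the first carries a factor [x]. As the constant depends on [q] alone, this
    yields [W_k -> 1]. *)
Lemma Cmod_G_sub_1 : (Cmod (G q x y z - 1) <= Cmod x * Series (gbound q))%R.
Proof.
  apply Rle_trans with (Cmod x * Series (fun n => gbound q (S n)))%R.
  - eapply is_series_Cmod_le; [apply Cmod_gterm_S_le|apply is_series_gterm_S|].
    apply (is_series_scal_l (V := R_NormedModule) (Cmod x)). apply Series_correct.
    apply (ex_series_incr_1 (gbound q)). apply ex_series_gbound.
  - apply Rmult_le_compat_l; [apply Cmod_ge_0|].
    rewrite (Series_incr_1 (gbound q)) by apply ex_series_gbound.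
    pose proof (gbound_ge_0 0). lra.
Qed.

Lemma Cmod_G_le : (Cmod (G q x y z) <= Series (gbound q))%R.
Proof.
  eapply is_series_Cmod_le; [apply Cmod_gterm_le|apply is_series_gterm|].
  apply Series_correct, ex_series_gbound.
Qed.

End Convergence.

(** Discharges a side condition of [field] by a hypothesis stating it up to [ring]. *)
Ltac nz :=
  cbv beta;
  match goal with
  | H : ?a <> _ |- ?b <> _ => solve [replace b with a by ring; exact H]
  end.

(** * Contiguous relations *)

Section Contiguous.

Variables q x y z : C.
Hypothesis Hq : (Cmod q < 1)%R.
Hypothesis Hx : (Cmod x <= 1)%R.
Hypothesis Hy : (Cmod y <= 1)%R.
Hypothesis Hz : (Cmod z <= Cmod q)%R.

Lemma one_sub_q2_neq_0 (n : nat) : 1 - q * q * q ^ (2 * n) <> 0.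
Proof.
  apply one_sub_neq_0. rewrite <- pow_2S.
  eapply Rle_lt_trans; [|apply Hq].
  replace (2 * S n)%nat with (S (S (2 * n))) by lia. now apply Cmod_pow_S_le.
Qed.

Lemma one_sub_z_neq_0 (n : nat) : 1 - z * q ^ (2 * n) <> 0.
Proof.
  apply one_sub_neq_0. eapply Rle_lt_trans; [|apply Hq].
  apply Cmod_mult_le_l; [easy|]. now apply Cmod_pow_le_1.
Qed.

(** This and the next two lemmas express shifted terms through one common term, that of
    [G(x q^2, y q^2, z q^4)]; a contiguous relation then reduces to an identity between rational
    coefficients in [q^(2n)]. *)
Lemma gterm_shift (n : nat) :
  gterm q x y z (S n) =
  - (q * x * (1 - y) * (1 - z * q ^ (2 * S n))) /
    ((1 - z) * (1 - z * (q * q)) * (1 - q * q * q ^ (2 * n))) *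
  gterm q (x * (q * q)) (y * (q * q)) (z * (q * q) * (q * q)) n.
Proof.
  pose proof (one_sub_z_neq_0 0) as Z0. pose proof (one_sub_z_neq_0 1) as Z1.
  rewrite pow_2S in Z1. simpl in Z0, Z1.
  assert (1 - z <> 0) by (intros E; apply Z0; rewrite <- E; ring).
  assert (1 - z * (q * q) <> 0) by (intros E; apply Z1; rewrite <- E; ring).
  induction n as [|n IH].
  - pose proof (one_sub_q2_neq_0 0) as Q0. rewrite pow_2S. simpl in *.
    field. repeat split; nz.
  - rewrite gterm_S, IH, gterm_S.
    pose proof (one_sub_z_neq_0 (S n)) as Z2. pose proof (one_sub_z_neq_0 (S (S n))) as Z3.
    pose proof (one_sub_q2_neq_0 n) as Q1. pose proof (one_sub_q2_neq_0 (S n)) as Q2.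
    rewrite !pow_2S in *. set (Q := q ^ (2 * n)) in *. clearbody Q.
    field. repeat split; nz.
Qed.

Lemma gterm_yz_shift (n : nat) :
  gterm q x (y * (q * q)) (z * (q * q)) (S n) =
  - (q * x * (1 - y * q ^ (2 * S n))) /
    ((1 - z * (q * q)) * (1 - q * q * q ^ (2 * n))) *
  gterm q (x * (q * q)) (y * (q * q)) (z * (q * q) * (q * q)) n.
Proof.
  pose proof (one_sub_z_neq_0 1) as Z1. rewrite pow_2S in Z1. simpl in Z1.
  induction n as [|n IH].
  - pose proof (one_sub_q2_neq_0 0) as Q0. rewrite pow_2S. simpl in *.
    field. repeat split; nz.
  - rewrite gterm_S, IH, gterm_S.
    pose proof (one_sub_z_neq_0 (S (S n))) as Z3.
    pose proof (one_sub_q2_neq_0 n) as Q1. pose proof (one_sub_q2_neq_0 (S n)) as Q2.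
    rewrite !pow_2S in *. set (Q := q ^ (2 * n)) in *. clearbody Q.
    field. repeat split; nz.
Qed.

Lemma gterm_xz_shift (n : nat) :
  gterm q (x * (q * q)) y (z * (q * q)) (S n) =
  - (q * x * (1 - y) * q ^ (2 * S n)) /
    ((1 - z * (q * q)) * (1 - q * q * q ^ (2 * n))) *
  gterm q (x * (q * q)) (y * (q * q)) (z * (q * q) * (q * q)) n.
Proof.
  pose proof (one_sub_z_neq_0 1) as Z1. rewrite pow_2S in Z1. simpl in Z1.
  induction n as [|n IH].
  - pose proof (one_sub_q2_neq_0 0) as Q0. rewrite pow_2S. simpl in *.
    field. repeat split; nz.
  - rewrite gterm_S, IH, gterm_S.
    pose proof (one_sub_z_neq_0 (S (S n))) as Z3.
    pose proof (one_sub_q2_neq_0 n) as Q1. pose proof (one_sub_q2_neq_0 (S n)) as Q2.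
    rewrite !pow_2S in *. set (Q := q ^ (2 * n)) in *. clearbody Q.
    field. repeat split; nz.
Qed.

Lemma is_series_gterm_scal (c : C) :
  is_series
    (fun n => c * gterm q (x * (q * q)) (y * (q * q)) (z * (q * q) * (q * q)) n)
    (c * G q (x * (q * q)) (y * (q * q)) (z * (q * q) * (q * q))).
Proof.
  apply (is_series_scal_l (V := C_NormedModule) c).
  assert (Hqq : (Cmod (q * q) <= 1)%R) by (apply Cmod_mult_le_l; lra).
  apply is_series_gterm; try easy; repeat apply Cmod_mult_le_l; lra.
Qed.

(** With [P = q^(2n+2)], the numerators combine as [(1-y)(1-zP) - (1-z)(1-yP) = (z-y)(1-P)], and
    [1-P] cancels the remaining denominator that depends on [n]. *)
Lemma G_contiguous_yz :
  G q x y z - G q x (y * (q * q)) (z * (q * q)) =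
  (y - z) * (q * x) / ((1 - z) * (1 - z * (q * q))) *
  G q (x * (q * q)) (y * (q * q)) (z * (q * q) * (q * q)).
Proof.
  assert (Hqq : (Cmod (q * q) <= 1)%R) by (apply Cmod_mult_le_l; lra).
  set (c := (y - z) * (q * x) / ((1 - z) * (1 - z * (q * q)))).
  pose proof (is_series_gterm_S q x y z Hq Hx Hy Hz) as H1.
  pose proof (is_series_gterm_S q x (y * (q * q)) (z * (q * q)) Hq Hx
    ltac:(now apply Cmod_mult_le_l) ltac:(now apply Cmod_mult_le_l)) as H2.
  pose proof (is_series_gterm_scal c) as H4.
  (* The initial terms are both 1 and cancel, so only the shifted series are compared. *)
  assert (E : forall A B : C, A - B = A - 1 - (B - 1)) by (intros; ring).
  rewrite E. apply (is_series_sub_eq _ _ _ _ _ _ H1 H2 H4). intros n.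
  rewrite gterm_shift, gterm_yz_shift. unfold c.
  pose proof (one_sub_z_neq_0 0) as Z0. pose proof (one_sub_z_neq_0 1) as Z1.
  rewrite pow_2S in *. simpl in Z0, Z1.
  pose proof (one_sub_q2_neq_0 n) as Q1.
  set (Q := q ^ (2 * n)) in *. clearbody Q.
  field. repeat split; nz.
Qed.

(** The cancellation is now [(1-zP) - (1-z)P = 1-P], again with [P = q^(2n+2)]. *)
Lemma G_contiguous_xz :
  G q x y z - G q (x * (q * q)) y (z * (q * q)) =
  - (q * x * (1 - y)) / ((1 - z) * (1 - z * (q * q))) *
  G q (x * (q * q)) (y * (q * q)) (z * (q * q) * (q * q)).
Proof.
  assert (Hqq : (Cmod (q * q) <= 1)%R) by (apply Cmod_mult_le_l; lra).
  set (c := - (q * x * (1 - y)) / ((1 - z) * (1 - z * (q * q)))).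
  pose proof (is_series_gterm_S q x y z Hq Hx Hy Hz) as H1.
  pose proof (is_series_gterm_S q (x * (q * q)) y (z * (q * q)) Hq
    ltac:(now apply Cmod_mult_le_l) Hy ltac:(now apply Cmod_mult_le_l)) as H2.
  pose proof (is_series_gterm_scal c) as H4.
  assert (E : forall A B : C, A - B = A - 1 - (B - 1)) by (intros; ring).
  rewrite E. apply (is_series_sub_eq _ _ _ _ _ _ H1 H2 H4). intros n.
  rewrite gterm_shift, gterm_xz_shift. unfold c.
  pose proof (one_sub_z_neq_0 0) as Z0. pose proof (one_sub_z_neq_0 1) as Z1.
  rewrite pow_2S in *. simpl in Z0, Z1.
  pose proof (one_sub_q2_neq_0 n) as Q1.
  set (Q := q ^ (2 * n)) in *. clearbody Q.
  field. repeat split; nz.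
Qed.

End Contiguous.

(** * Rogers-Fine identity and the false theta series *)

Lemma is_series_gterm_scal_S (q x y z c : C) :
  (Cmod q < 1)%R -> (Cmod x <= 1)%R -> (Cmod y <= 1)%R -> (Cmod z <= Cmod q)%R ->
  is_series (fun n => c * gterm q x y z (S n)) (c * (G q x y z - 1)).
Proof.
  intros Hq Hx Hy Hz. apply (is_series_scal_l (V := C_NormedModule) c).
  now apply is_series_gterm_S.
Qed.

Lemma gterm_scale (q x y z : C) (n : nat) :
  gterm q (x * (q * q)) y z n = q ^ (2 * n) * gterm q x y z n.
Proof.
  induction n as [|n IH]; [simpl; ring|].
  cbn [gterm]. rewrite IH, pow_2S. unfold Cdiv. ring.
Qed.

(** For [y = q^2] the factor [(q^2; q^2)_n] cancels, leaving [(-1)^n q^(n^2) x^n / (z; q^2)_n], for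
    which an index shift is a parameter shift. *)
Lemma gterm_q2_shift (q x z : C) (n : nat) :
  (Cmod q < 1)%R -> (Cmod z <= Cmod q)%R ->
  gterm q x (q * q) z (S n) =
  - (q * x) / (1 - z) * gterm q (x * (q * q)) (q * q) (z * (q * q)) n.
Proof.
  intros Hq Hz.
  pose proof (one_sub_z_neq_0 q z Hq Hz 0) as Z0. simpl in Z0.
  induction n as [|n IH].
  - pose proof (one_sub_q2_neq_0 q Hq 0) as Q0. simpl in *.
    field. repeat split; nz.
  - rewrite gterm_S, IH, gterm_S.
    pose proof (one_sub_z_neq_0 q z Hq Hz (S n)) as Z3.
    pose proof (one_sub_q2_neq_0 q Hq n) as Q1.
    pose proof (one_sub_q2_neq_0 q Hq (S n)) as Q2.
    rewrite !pow_2S in *. set (Q := q ^ (2 * n)) in *. clearbody Q.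
    field. repeat split; nz.
Qed.

(* One step of the Rogers-Fine identity in the limit where the upper parameter
   tends to infinity. *)
Lemma G_rogers_fine (q x z : C) :
  (Cmod q < 1)%R -> (Cmod x <= 1)%R -> (Cmod z <= Cmod q)%R ->
  G q x (q * q) z =
  1 - q * x - q * x * (z - q * (x * (q * q))) / (1 - z) *
    G q (x * (q * q) * (q * q)) (q * q) (z * (q * q)).
Proof.
  intros Hq Hx Hz.
  assert (Hqq : (Cmod (q * q) <= 1)%R) by (apply Cmod_mult_le_l; lra).
  assert (Hx' : (Cmod (x * (q * q)) <= 1)%R) by now apply Cmod_mult_le_l.
  assert (Hx'' : (Cmod (x * (q * q) * (q * q)) <= 1)%R) by now apply Cmod_mult_le_l.
  assert (Hz' : (Cmod (z * (q * q)) <= Cmod q)%R) by now apply Cmod_mult_le_l.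
  pose proof (one_sub_z_neq_0 q z Hq Hz 0) as Z0. simpl in Z0.
  set (P := G q (x * (q * q)) (q * q) (z * (q * q))).
  set (K := G q (x * (q * q) * (q * q)) (q * q) (z * (q * q))).
  assert (E1 : G q x (q * q) z - 1 = - (q * x) / (1 - z) * P).
  { apply (is_series_ext_eq (fun n => gterm q x (q * q) z (S n))
      (fun n => - (q * x) / (1 - z) * gterm q (x * (q * q)) (q * q) (z * (q * q)) n)).
    - now apply is_series_gterm_S.
    - apply (is_series_scal_l (V := C_NormedModule)). now apply is_series_gterm.
    - intros n. now apply gterm_q2_shift. }
  (* Terms of [K] are those of [P] times [q^(2n)]. In the difference, the term of [P] of index [n+1]
     is multiplied by [1 - z q^(2n+2)], which cancels its newest denominator factor and leaves a
     multiple of the term of [K] of index [n]. Eliminating [P] between [E1] and [E2] gives the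
     claim. *)
  assert (E2 : P - 1 - z * (K - 1) = - (q * (x * (q * q))) * K).
  { apply (is_series_sub_eq
      (fun n => gterm q (x * (q * q)) (q * q) (z * (q * q)) (S n))
      (fun n => z * gterm q (x * (q * q) * (q * q)) (q * q) (z * (q * q)) (S n))
      (fun n => - (q * (x * (q * q))) *
         gterm q (x * (q * q) * (q * q)) (q * q) (z * (q * q)) n)).
    - now apply is_series_gterm_S.
    - now apply is_series_gterm_scal_S.
    - apply (is_series_scal_l (V := C_NormedModule)). now apply is_series_gterm.
    - intros n. rewrite !gterm_scale with (x := x * (q * q)). cbn [gterm].
      pose proof (one_sub_z_neq_0 q z Hq Hz (S n)) as Z3.
      pose proof (one_sub_q2_neq_0 q Hq n) as Q1.
      rewrite !pow_2S in *. set (Q := q ^ (2 * n)) in *. clearbody Q.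
      field. repeat split; nz. }
  replace P with (1 + z * (K - 1) + - (q * (x * (q * q))) * K) in E1
    by (rewrite <- E2; ring).
  replace (G q x (q * q) z) with (G q x (q * q) z - 1 + 1) by ring.
  rewrite E1. field. nz.
Qed.

Section FalseTheta.

Variable q : C.
Hypothesis Hq : (Cmod q < 1)%R.

(** The function reached from [W_1/(1-q)], the case [j = 0], after [j] Rogers-Fine steps, each
    replacing [x] by [x q^4] and [z] by [z q^2]. *)
Definition theta_tail (j : nat) : C :=
  G q (q ^ (4 * j + 1)) (q * q) (q ^ (2 * j + 3)) / (1 - q ^ (2 * j + 1)).

Lemma one_sub_pow_neq_0 (n : nat) : 1 - q ^ S n <> 0.
Proof.
  apply one_sub_neq_0. eapply Rle_lt_trans; [now apply Cmod_pow_S_le|easy].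
Qed.

(** At these parameters both [1 - qx = 1 - q^(4j+2)] and [z - q^3 x = q^(2j+3) (1 - q^(2j+1))] are
    divisible by [1 - q^(2j+1)], while [1 - z] is the denominator of [theta_tail (S j)]. *)
Lemma theta_tail_rec (j : nat) :
  theta_tail j = 1 + q ^ (2 * j + 1) - q ^ (6 * j + 5) * theta_tail (S j).
Proof.
  unfold theta_tail.
  pose proof (one_sub_pow_neq_0 (2 * j)) as Z1.
  pose proof (one_sub_pow_neq_0 (2 * j + 2)) as Z3.
  rewrite G_rogers_fine; try easy.
  2: now apply Cmod_pow_le_1.
  2: rewrite Nat.add_succ_r; now apply Cmod_pow_S_le.
  replace (q ^ (4 * S j + 1)) with (q ^ (4 * j + 1) * (q * q) * (q * q)).
  2: { replace (4 * S j + 1)%nat with (4 * j + 1 + 4)%nat by lia.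
       rewrite (Cpow_add_r _ (4 * j + 1)). simpl. ring. }
  replace (q ^ (2 * S j + 3)) with (q ^ (2 * j + 3) * (q * q)).
  2: { replace (2 * S j + 3)%nat with (2 * j + 3 + 2)%nat by lia.
       rewrite (Cpow_add_r _ (2 * j + 3)). simpl. ring. }
  set (K := G _ _ _ _). clearbody K.
  replace (2 * S j + 1)%nat with (S (2 * j + 2)) by lia.
  replace (q ^ (4 * j + 1)) with (q ^ j * q ^ j * q ^ j * q ^ j * q).
  2: { replace (4 * j + 1)%nat with (j + j + j + j + 1)%nat by lia.
       rewrite !Cpow_add_r. simpl. ring. }
  replace (q ^ (6 * j + 5)) with
    (q ^ j * q ^ j * q ^ j * q ^ j * q ^ j * q ^ j * (q * q * q * q * q)).
  2: { replace (6 * j + 5)%nat with (j + j + j + j + j + j + 5)%nat by lia.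
       rewrite !Cpow_add_r. simpl. ring. }
  replace (q ^ (2 * j + 1)) with (q ^ S (2 * j)) by (f_equal; lia).
  replace (q ^ (2 * j + 3)) with (q ^ S (2 * j + 2)) by (f_equal; lia).
  replace (q ^ S (2 * j + 2)) with (q ^ j * q ^ j * (q * q * q)) in *.
  2: { replace (S (2 * j + 2)) with (j + j + 3)%nat by lia.
       rewrite !Cpow_add_r. simpl. ring. }
  replace (q ^ S (2 * j)) with (q ^ j * q ^ j * q) in *.
  2: { replace (S (2 * j)) with (j + j + 1)%nat by lia.
       rewrite !Cpow_add_r. simpl. ring. }
  set (Q := q ^ j) in *. clearbody Q. field. repeat split; nz.
Qed.

Lemma Cmod_theta_tail_le (j : nat) :
  (Cmod (theta_tail j) <= Series (gbound q) / (1 - Cmod q))%R.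
Proof.
  unfold theta_tail. pose proof (one_sub_pow_neq_0 (2 * j)) as Z1.
  rewrite (Nat.add_1_r (2 * j)), Cmod_div by easy.
  assert (Hqq : (Cmod (q * q) <= 1)%R) by (apply Cmod_mult_le_l; lra).
  unfold Rdiv. apply Rmult_le_compat.
  - apply Cmod_ge_0.
  - left. apply Rinv_0_lt_compat. now apply Cmod_gt_0.
  - apply Cmod_G_le; try easy; [now apply Cmod_pow_le_1|].
    rewrite Nat.add_succ_r. now apply Cmod_pow_S_le.
  - apply Rinv_le_contravar; [lra|].
    apply Cmod_one_sub_ge. now apply Cmod_pow_S_le.
Qed.

Definition theta_term (n : nat) : C :=
  (- (1)) ^ n * q ^ (n * (3 * n + 2)) * (1 + q ^ (2 * n + 1)).

(** Iterating the recurrence accumulates the exponents: [n(3n+2) + (6n+5) = (n+1)(3(n+1)+2)]. *)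
Lemma theta_partial_sum (N : nat) :
  sum_n theta_term N = theta_tail 0 -
    (- (1)) ^ S N * q ^ (S N * (3 * S N + 2)) * theta_tail (S N).
Proof.
  induction N as [|N IH].
  - rewrite sum_O, (theta_tail_rec 0). unfold theta_term. simpl. ring.
  - rewrite sum_Sn, IH, (theta_tail_rec (S N)). unfold theta_term.
    change plus with Cplus.
    replace (S (S N) * (3 * S (S N) + 2))%nat
      with (S N * (3 * S N + 2) + (6 * S N + 5))%nat by lia.
    rewrite (Cpow_add_r q (S N * (3 * S N + 2)) (6 * S N + 5)),
      (Cpow_S _ (S N)).
    match goal with |- ?l = ?r => change (@eq C l r) end. ring.
Qed.

Lemma is_series_theta : is_series theta_term (theta_tail 0).
Proof.
  pose proof (Cmod_ge_0 q) as Hq0.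
  set (B := (Series (gbound q) / (1 - Cmod q))%R).
  assert (HB : (0 <= B)%R).
  { eapply Rle_trans; [apply Cmod_ge_0|apply (Cmod_theta_tail_le 0)]. }
  apply filterlim_C_eps. intros eps He.
  destruct (eventually_mult_pow_lt B (Cmod q) eps HB (conj Hq0 Hq) He) as [N HN].
  exists N. intros n Hn. rewrite theta_partial_sum.
  eapply Rle_lt_trans; [|apply (HN (S n)); lia].
  replace (_ - _ - _) with
    (- ((- (1)) ^ S n * q ^ (S n * (3 * S n + 2)) * theta_tail (S n))) by ring.
  rewrite Cmod_opp, !Cmod_mult, Cmod_pow, Cmod_m1, pow1, Rmult_1_l, Rmult_comm.
  apply Rmult_le_compat; try apply Cmod_ge_0; [apply Cmod_theta_tail_le|].
  (* Of the quadratic exponent a single factor [q^(n+1)] is kept; it suffices because the tails are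
     bounded by [B]. *)
  rewrite Cpow_mult_r, <- Cmod_pow.
  replace (3 * S n + 2)%nat with (S (3 * S n + 1)) by lia.
  apply Cmod_pow_S_le. eapply Rle_lt_trans; [now apply Cmod_pow_S_le|easy].
Qed.

End FalseTheta.

(** * Solution of the recurrence *)

Lemma Cmod_pow_le_pow (q : C) (m n : nat) :
  (Cmod q < 1)%R -> (m <= n)%nat -> (Cmod (q ^ n) <= Cmod q ^ m)%R.
Proof.
  intros Hq Hmn. replace n with (m + (n - m))%nat by lia.
  rewrite Cpow_add_r. apply Cmod_mult_le_l; [rewrite Cmod_pow; lra|].
  now apply Cmod_pow_le_1.
Qed.

Lemma nat_parity (k : nat) : exists m, k = (2 * m)%nat \/ k = S (2 * m).
Proof.
  exists (Nat.div2 k). destruct (Nat.Even_or_Odd k) as [[m ->]|[m ->]].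
  - left. now rewrite Nat.div2_double.
  - right. rewrite Nat.add_1_r, Nat.div2_succ_double. lia.
Qed.

Section Solution.

Variable q : C.
Variables a b : nat -> C.
Hypothesis Hq : (Cmod q < 1)%R.
Hypothesis Hb : forall k : nat, b k = 1 - q ^ (2 * k + 1).
Hypothesis Ha_odd : forall n : nat, (1 <= n)%nat ->
  a (2 * n - 1)%nat = q ^ (4 * n - 2) - q ^ (6 * n - 3).
Hypothesis Ha_even : forall n : nat, (1 <= n)%nat ->
  a (2 * n)%nat = q ^ (4 * n) - q ^ (2 * n).

(** The two halvings encode both parities at once: an even-to-odd step shifts [y] and [z], an
    odd-to-even step shifts [x] and [z], and two steps shift all three. *)
Definition W (k : nat) : C :=
  G q (q ^ (2 * Nat.div2 k + 1)) (q ^ (2 * Nat.div2 (S k))) (q ^ (2 * k + 1)).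

Lemma a_odd (m : nat) : a (S (2 * m)) = q ^ (4 * m + 2) - q ^ (6 * m + 3).
Proof.
  replace (S (2 * m)) with (2 * S m - 1)%nat by lia. rewrite Ha_odd by lia.
  f_equal; f_equal; lia.
Qed.

Lemma a_even (m : nat) : a (S (S (2 * m))) = q ^ (4 * m + 4) - q ^ (2 * m + 2).
Proof.
  replace (S (S (2 * m))) with (2 * S m)%nat by lia. rewrite Ha_even by lia.
  f_equal; f_equal; lia.
Qed.

Lemma b_neq_0 (k : nat) : b k <> 0.
Proof. rewrite Hb, Nat.add_1_r. now apply one_sub_pow_neq_0. Qed.

Lemma W_rec (k : nat) : W k = W (S k) + a (S k) / (b k * b (S k)) * W (S (S k)).
Proof.
  pose proof (b_neq_0 k) as B0. pose proof (b_neq_0 (S k)) as B1.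
  assert (E : forall A B C D : C, A - B = C -> C = D -> A = B + D)
    by (intros A B C D <- <-; ring).
  destruct (nat_parity k) as [m Hk].
  assert (D0 : Nat.div2 (2 * m) = m) by apply Nat.div2_double.
  assert (D1 : Nat.div2 (S (2 * m)) = m) by apply Nat.div2_succ_double.
  assert (D2 : Nat.div2 (S (S (2 * m))) = S m) by (now rewrite <- D0 at 2).
  assert (D3 : Nat.div2 (S (S (S (2 * m)))) = S m) by (now rewrite <- D1 at 2).
  assert (D4 : Nat.div2 (S (S (S (S (2 * m))))) = S (S m)) by (now rewrite <- D0 at 2).
  destruct Hk as [->| ->]; unfold W; rewrite ?D0, ?D1, ?D2, ?D3, ?D4.
  (* Even index: [G_contiguous_yz], where [(y - z) q x] is [a_(2m+1)] and the denominator is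
     [b_k b_(k+1)]. *)
  - replace (q ^ (2 * S (2 * m) + 1)) with (q ^ (2 * (2 * m) + 1) * (q * q)).
    2: { replace (2 * S (2 * m) + 1)%nat with (2 * (2 * m) + 1 + 2)%nat by lia.
         rewrite (Cpow_add_r _ (2 * (2 * m) + 1) 2). simpl. ring. }
    replace (q ^ (2 * S (S (2 * m)) + 1))
      with (q ^ (2 * (2 * m) + 1) * (q * q) * (q * q)).
    2: { replace (2 * S (S (2 * m)) + 1)%nat with (2 * (2 * m) + 1 + 4)%nat by lia.
         rewrite (Cpow_add_r _ (2 * (2 * m) + 1) 4). simpl. ring. }
    replace (q ^ (2 * S m)) with (q ^ (2 * m) * (q * q)) by (rewrite pow_2S; ring).
    replace (q ^ (2 * S m + 1)) with (q ^ (2 * m + 1) * (q * q)).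
    2: { replace (2 * S m + 1)%nat with (2 * m + 1 + 2)%nat by lia.
         rewrite (Cpow_add_r _ (2 * m + 1) 2). simpl. ring. }
    eapply E; [apply G_contiguous_yz; try easy; try now apply Cmod_pow_le_1|].
    { rewrite (Nat.add_1_r (2 * (2 * m))). now apply Cmod_pow_S_le. }
    f_equal. rewrite a_odd, !Hb in *.
    replace (2 * S (2 * m) + 1)%nat with (2 * m + 2 * m + 3)%nat in * by lia.
    replace (2 * (2 * m) + 1)%nat with (2 * m + 2 * m + 1)%nat in * by lia.
    replace (4 * m + 2)%nat with (2 * m + 2 * m + 2)%nat by lia.
    replace (6 * m + 3)%nat with (2 * m + 2 * m + 2 * m + 3)%nat by lia.
    rewrite !Cpow_add_r in *. set (Q := q ^ (2 * m)) in *. clearbody Q.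
    simpl in *. field. repeat split; nz.
  (* Odd index: [G_contiguous_xz], where [- q x (1 - y)] is [a_(2m+2)]. *)
  - replace (q ^ (2 * S (S (2 * m)) + 1)) with (q ^ (2 * S (2 * m) + 1) * (q * q)).
    2: { replace (2 * S (S (2 * m)) + 1)%nat with (2 * S (2 * m) + 1 + 2)%nat by lia.
         rewrite (Cpow_add_r _ (2 * S (2 * m) + 1) 2). simpl. ring. }
    replace (q ^ (2 * S (S (S (2 * m))) + 1))
      with (q ^ (2 * S (2 * m) + 1) * (q * q) * (q * q)).
    2: { replace (2 * S (S (S (2 * m))) + 1)%nat
           with (2 * S (2 * m) + 1 + 4)%nat by lia.
         rewrite (Cpow_add_r _ (2 * S (2 * m) + 1) 4). simpl. ring. }
    replace (q ^ (2 * S (S m))) with (q ^ (2 * S m) * (q * q))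
      by (rewrite (pow_2S q (S m)); ring).
    replace (q ^ (2 * S m + 1)) with (q ^ (2 * m + 1) * (q * q)).
    2: { replace (2 * S m + 1)%nat with (2 * m + 1 + 2)%nat by lia.
         rewrite (Cpow_add_r _ (2 * m + 1) 2). simpl. ring. }
    eapply E; [apply G_contiguous_xz; try easy; try now apply Cmod_pow_le_1|].
    { rewrite (Nat.add_1_r (2 * S (2 * m))). now apply Cmod_pow_S_le. }
    f_equal. rewrite a_even, !Hb in *.
    replace (2 * S (S (2 * m)) + 1)%nat with (2 * m + 2 * m + 5)%nat in * by lia.
    replace (2 * S (2 * m) + 1)%nat with (2 * m + 2 * m + 3)%nat in * by lia.
    replace (4 * m + 4)%nat with (2 * m + 2 * m + 4)%nat by lia.
    rewrite pow_2S.
    rewrite !Cpow_add_r in *. set (Q := q ^ (2 * m)) in *. clearbody Q.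
    simpl in *. field. repeat split; nz.
Qed.

(** Here [y = 1], so the factor [1 - y] kills every term after the first. *)
Lemma W_0 : W 0 = 1.
Proof.
  unfold W. simpl Nat.div2. change (q ^ (2 * 0)) with (RtoC 1).
  set (x := q ^ (2 * 0 + 1)).
  assert (Hx : (Cmod x <= Cmod q)%R) by now apply Cmod_pow_S_le.
  assert (Hs : forall n, gterm q x 1 x (S n) = 0).
  { induction n as [|n IH]; [simpl; unfold Cdiv; ring|].
    cbn [gterm] in *. rewrite IH. ring. }
  pose proof (is_series_gterm_S q x 1 x Hq ltac:(lra) ltac:(rewrite Cmod_1; lra) Hx)
    as H.
  replace (G q x 1 x) with (1 + (G q x 1 x - 1)) by ring.
  (* A series of zeros is its own difference with itself, so its sum is 0. *)
  rewrite <- (is_series_sub_eq _ _ _ _ _ _ H H H); [ring|].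
  intros n. rewrite Hs. ring.
Qed.

(* [V k = W k / bprod k] turns [W_rec] into the three-term recurrence of the
   continued fraction, with [V 0 = 1] and [V 1] the false theta series. *)
Fixpoint bprod (k : nat) : C :=
  match k with
  | O => 1
  | S j => bprod j * b j
  end.

Lemma bprod_neq_0 (k : nat) : bprod k <> 0.
Proof.
  induction k as [|k IH]; simpl.
  - intros E. apply (f_equal fst) in E. simpl in E. lra.
  - apply Cmult_neq_0; [easy|apply b_neq_0].
Qed.

Definition V (k : nat) : C := W k / bprod k.

Lemma V_recurrence (k : nat) : V k = b k * V (S k) + a (S k) * V (S (S k)).
Proof.
  unfold V. rewrite W_rec. simpl.
  pose proof (bprod_neq_0 k). pose proof (b_neq_0 k). pose proof (b_neq_0 (S k)).
  field. easy.
Qed.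

Lemma V_1 : V 1 = theta_tail q 0.
Proof.
  unfold V, W, theta_tail. simpl Nat.div2. cbn [bprod]. rewrite Hb.
  f_equal; [|simpl; ring]. f_equal. simpl. ring.
Qed.

Lemma Cmod_W_sub_1 (k : nat) :
  (Cmod (W k - 1) <= Series (gbound q) * Cmod q ^ S (Nat.div2 k))%R.
Proof.
  pose proof (Cmod_ge_0 q) as Hq0.
  unfold W. eapply Rle_trans.
  - apply Cmod_G_sub_1; try easy; try now apply Cmod_pow_le_1.
    rewrite (Nat.add_1_r (2 * k)). now apply Cmod_pow_S_le.
  - rewrite Rmult_comm. apply Rmult_le_compat_l.
    + eapply Rle_trans; [apply Cmod_ge_0|].
      (* Nonnegativity of the constant is read off from its bounding the modulus of a value of
         [G]. *)
      apply (Cmod_G_le q 0 0 0); rewrite ?Cmod_0; lra.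
    + apply Cmod_pow_le_pow; [easy|]. generalize (Nat.div2 k). lia.
Qed.

Lemma a_neq_0 (k : nat) : q <> 0 -> a (S k) <> 0.
Proof.
  intros Hq0. destruct (nat_parity k) as [m [->| ->]].
  - rewrite a_odd.
    replace (q ^ (4 * m + 2) - q ^ (6 * m + 3))
      with (q ^ (4 * m + 2) * (1 - q ^ S (2 * m))).
    + apply Cmult_neq_0; [now apply Cpow_nz|now apply one_sub_pow_neq_0].
    + replace (6 * m + 3)%nat with (4 * m + 2 + S (2 * m))%nat by lia.
      rewrite (Cpow_add_r _ (4 * m + 2) (S (2 * m))). ring.
  - rewrite a_even.
    replace (q ^ (4 * m + 4) - q ^ (2 * m + 2))
      with (q ^ (2 * m + 2) * - (1 - q ^ S (2 * m + 1))).
    + apply Cmult_neq_0; [now apply Cpow_nz|].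
      intros E. apply (one_sub_pow_neq_0 q Hq (2 * m + 1)).
      replace (1 - _) with (- - (1 - q ^ S (2 * m + 1))) by ring.
      rewrite E. ring.
    + replace (4 * m + 4)%nat with (2 * m + 2 + S (2 * m + 1))%nat by lia.
      rewrite (Cpow_add_r _ (2 * m + 2) (S (2 * m + 1))). ring.
Qed.

Lemma Cmod_a_le (k : nat) : (Cmod (a (S k)) <= 2 * Cmod q ^ S (Nat.div2 k))%R.
Proof.
  destruct (nat_parity k) as [m [->| ->]];
    rewrite ?Nat.div2_double, ?Nat.div2_succ_double, ?a_odd, ?a_even;
    unfold Cminus; (eapply Rle_trans; [apply Cmod_triangle|]); rewrite Cmod_opp.
  - pose proof (Cmod_pow_le_pow q (S m) (4 * m + 2) Hq ltac:(lia)).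
    pose proof (Cmod_pow_le_pow q (S m) (6 * m + 3) Hq ltac:(lia)). lra.
  - pose proof (Cmod_pow_le_pow q (S m) (4 * m + 4) Hq ltac:(lia)).
    pose proof (Cmod_pow_le_pow q (S m) (2 * m + 2) Hq ltac:(lia)). lra.
Qed.

Lemma Cmod_b_sub_1 (k : nat) : (Cmod (b k - 1) <= Cmod q ^ S (Nat.div2 k))%R.
Proof.
  rewrite Hb. replace (1 - q ^ (2 * k + 1) - 1) with (- q ^ (2 * k + 1)) by ring.
  rewrite Cmod_opp. apply Cmod_pow_le_pow; [easy|].
  pose proof (Nat.div2_decr k k (Nat.le_succ_diag_r k)). revert H.
  generalize (Nat.div2 k). lia.
Qed.

(* For [q = 0] all the [a k] vanish, so the backward steps, which need
   [a k <> 0], must be avoided by taking [K = 0]. *)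
Lemma decay_threshold : exists K : nat, (q = 0 -> K = O) /\
  forall k, (K <= k)%nat ->
    ((Series (gbound q) + 2) * Cmod q ^ S (Nat.div2 k) <= 1 / 8)%R.
Proof.
  pose proof (Cmod_ge_0 q) as Hq0.
  assert (HS : (0 <= Series (gbound q) + 2)%R).
  { pose proof (Cmod_W_sub_1 0) as H. rewrite W_0 in H.
    pose proof (Cmod_G_le q 0 0 0 Hq ltac:(rewrite Cmod_0; lra)
      ltac:(rewrite Cmod_0; lra) ltac:(rewrite Cmod_0; lra)) as H1.
    pose proof (Cmod_ge_0 (G q 0 0 0)). lra. }
  destruct (Ceq_dec q 0) as [E|E].
  (* The exponent is a successor, so for [q = 0] the bound is 0 already at [k = 0]. *)
  - exists O. split; [easy|]. intros k _. rewrite E at 2. rewrite Cmod_0. simpl. lra.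
  - destruct (eventually_mult_pow_lt _ (Cmod q) (1 / 8) HS (conj Hq0 Hq)) as [N HN];
      [lra|].
    exists (2 * N)%nat. split; [easy|]. intros k Hk. left. apply HN.
    destruct (nat_parity k) as [m [->| ->]];
      rewrite ?Nat.div2_double, ?Nat.div2_succ_double; lia.
Qed.

Lemma cf_value_theta : cf_has_value a b (Cfin (theta_tail q 0)).
Proof.
  destruct decay_threshold as [K [HK0 HK]].
  replace (Cfin (theta_tail q 0)) with (Cbar_div (V 1) (Cfin (V 0))).
  2: { replace (V 0) with (RtoC 1) by (unfold V; rewrite W_0; simpl; field).
       rewrite V_1. simpl. destruct (Ceq_dec 1 0) as [E|_].
       - apply (f_equal fst) in E. simpl in E. lra.
       - f_equal. field. }
  (* The constant [Series (gbound q) + 2] dominates the three decay constants: 1 for [b], 2 for [a]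
     and [Series (gbound q)] for [W]. *)
  assert (Hd : forall k, (K <= k)%nat ->
    (Cmod (b k - 1) <= 1 / 8 /\ Cmod (a (S k)) <= 1 / 8 /\
     Cmod (W k - 1) <= 1 / 8)%R).
  { intros k Hk. specialize (HK k Hk).
    pose proof (Cmod_b_sub_1 k). pose proof (Cmod_a_le k).
    pose proof (Cmod_W_sub_1 k). pose proof (Cmod_ge_0 (W k - 1)).
    assert (0 <= Cmod q ^ S (Nat.div2 k))%R by apply pow_le, Cmod_ge_0.
    repeat split; lra. }
  assert (HW : forall k, (K <= k)%nat -> (7 / 8 <= Cmod (W k) <= 9 / 8)%R).
  { intros k Hk. destruct (Hd k Hk) as [_ [_ H]].
    pose proof (Cmod_sub_ge (W k) 1) as H1.
    pose proof (Cmod_sub_ge 1 (W k)) as H2.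
    rewrite Cmod_1, (Cmod_sub_comm 1) in *. lra. }
  assert (HV : forall k, (K <= k)%nat -> V k <> 0).
  { intros k Hk E. assert (W k <> 0) as HWk by (apply Cmod_gt_0; specialize (HW k Hk); lra).
    apply HWk. unfold V in E. pose proof (bprod_neq_0 k).
    replace (W k) with (W k / bprod k * bprod k) by (now field). rewrite E. ring. }
  apply (cf_value_of_slow_solution a b V K).
  - intros k Hk. apply a_neq_0. intros E. specialize (HK0 E). lia.
  - intros k Hk. destruct (Hd k Hk) as [H _]. lra.
  - intros k Hk. now destruct (Hd k Hk) as [_ [H _]].
  - exact V_recurrence.
  - exact HV.
  - intros k Hk. pose proof (bprod_neq_0 k) as Hp. pose proof (b_neq_0 k) as Hbk.
    (* The ratio is at most [(9/8) / (7/8)^2 = 72/49 < 2], as [V_slow] demands. *)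
    assert (E : V (S k) = W (S k) / (W k * b k) * V k).
    { assert (W k <> 0) by (apply Cmod_gt_0; specialize (HW k Hk); lra).
      unfold V. simpl. field. easy. }
    rewrite E, Cmod_mult. apply Rmult_le_compat_r; [apply Cmod_ge_0|].
    pose proof (HW k Hk). pose proof (HW (S k) ltac:(lia)).
    destruct (Hd k Hk) as [H1 _].
    pose proof (Cmod_sub_ge 1 (b k)) as H2. rewrite Cmod_1, Cmod_sub_comm in H2.
    rewrite Cmod_div, Cmod_mult
      by (apply Cmult_neq_0; [apply Cmod_gt_0; lra|easy]).
    apply Rle_div_l; nra.
Qed.

End Solution.

Theorem corollary2p5 :
  forall (q : C) (a b : nat -> C),
    (Cmod q < 1)%R ->
    (forall k : nat, b k = 1 - q ^ (2 * k + 1)) ->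
    (forall n : nat, (1 <= n)%nat ->
       a (2 * n - 1)%nat = q ^ (4 * n - 2) - q ^ (6 * n - 3)) ->
    (forall n : nat, (1 <= n)%nat ->
       a (2 * n)%nat = q ^ (4 * n) - q ^ (2 * n)) ->
    exists s : C,
      is_series (fun n : nat =>
        (- (1)) ^ n * q ^ (n * (3 * n + 2)) * (1 + q ^ (2 * n + 1))) s /\
      cf_has_value a b (Cfin s).
Proof.
  intros q a b Hq Hb Ha_odd Ha_even. exists (theta_tail q 0). split.
  - now apply is_series_theta.
  - now apply cf_value_theta.
Qed.
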